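(* Every weakly nil clean ring of bounded index is strongly $\pi$-regular.
   Context: Rings are associative with unity, not necessarily commutative. A ring $R$ is weakly nil clean if for every $a\in R$ there exist an idempotent $e\in R$ and a nilpotent $q\in R$ such that $a-e-q\in eRa$. A ring $R$ is of bounded index (of nilpotence) if there exists a positive integer $n$ such that $x^n=0$ for every nilpotent $x\in R$. A ring $R$ is strongly $\pi$-regular if for every $a\in R$ there exists a positive integer $n$ such that $a^n\in a^{n+1}R$. *)

(* Defs.v *)
From mathcomp Require Import all_boot all_algebra.

Set Implicit Arguments.
Unset Strict Implicit.
Unset Printing Implicit Defensive.

Import GRing.Theory.
Local Open Scope ring_scope.

(* [pzRingType] is the structure of associative unital rings, the zero ring
   included; [nzRingType] would add [1 != 0]. *)

Definition is_idempotent (R : pzRingType) (e : R) : Prop := e * e = e.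

Definition is_nilpotent (R : pzRingType) (q : R) : Prop :=
  exists n : nat, (0 < n)%N /\ q ^+ n = 0.

Definition weakly_nil_clean (R : pzRingType) : Prop :=
  forall a : R, exists e q : R,
    [/\ is_idempotent e, is_nilpotent q
      & exists r : R, a - e - q = e * r * a].

Definition bounded_index (R : pzRingType) : Prop :=
  exists n : nat, (0 < n)%N /\ forall x : R, is_nilpotent x -> x ^+ n = 0.

Definition strongly_pi_regular (R : pzRingType) : Prop :=
  forall a : R, exists n : nat, (0 < n)%N /\ exists r : R, a ^+ n = a ^+ n.+1 * r.

(* Main.v *)
(* If a^m is never in a^(m+1) R, some ideal P is maximal among those containing no
   a^m - a^(m+1) r, and P is prime.  For each x there is an idempotent g in R x
   such that x is congruent to a nilpotent modulo the ideal generated by g; with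
   bounded index and Levitzki's theorem modulo P, every left ideal not inside P
   contains an idempotent outside P.  Orthogonal idempotents of R outside P yield
   a nilpotent element of index at least their number, so there are boundedly
   many, and hence every left ideal L is, modulo P, generated by an idempotent
   g in L.  Applied to L = {x | x a^k in P for some k}, this gives one k that
   serves all x in L; applied to R a^(k+1), it gives y with
   (1 - a^(k+1) y) a^(k+1) in P.  So 1 - a^(k+1) y is in L, and
   a^k - a^(k+1) y a^k is in P, a contradiction. *)

Require Import Defs.
From mathcomp Require Import all_boot all_algebra.
From mathcomp Require Import classical_sets boolp.

Set Implicit Arguments.
Unset Strict Implicit.
Unset Printing Implicit Defensive.

Import GRing.Theory.
Local Open Scope ring_scope.

(** * Ideals and prime ideals *)

(* The empty set qualifies; [0] is required separately where it matters. *)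
Definition left_ideal (R : pzRingType) (L : set R) : Prop :=
  (forall x y, L x -> L y -> L (x + y)) /\ (forall r x, L x -> L (r * x)).

Definition ideal (R : pzRingType) (I : set R) : Prop :=
  left_ideal I /\ (forall x r, I x -> I (x * r)).

Definition prime_ideal (R : pzRingType) (P : set R) : Prop :=
  [/\ P 0, ideal P &
      forall x y, (forall r, P (x * r * y)) -> P x \/ P y].

Lemma left_idealB (R : pzRingType) (L : set R) (hL : left_ideal L) (x y : R) :
  L x -> L y -> L (x - y).
Proof. by move: hL => [LD LM] Lx Ly; apply: LD => //; rewrite -mulN1r; apply: LM. Qed.

Lemma ideal_subX (R : pzRingType) (I : set R) (hI : ideal I) (x y : R) (n : nat) :
  I 0 -> I (x - y) -> I (x ^+ n - y ^+ n).
Proof.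
move: hI => [[ID IM] IMr] I0 Ixy; elim: n => [|n IHn]; first by rewrite subrr.
have -> : x ^+ n.+1 - y ^+ n.+1 = x * (x ^+ n - y ^+ n) + (x - y) * y ^+ n.
  by rewrite mulrBr mulrBl -!exprS addrA subrK.
by apply: ID; [apply: IM | apply: IMr].
Qed.

Lemma maximal_avoiding_ideal (R : pzRingType) (U : set R) :
  ~ U 0 -> exists P : set R, [/\ P 0, ideal P, forall x, U x -> ~ P x &
    forall I, ideal I -> (P `<=` I)%classic -> ~ (I `<=` P)%classic ->
      exists2 x, U x & I x].
Proof.
move=> U0; pose F (I : set R) := ideal I /\ forall x, U x -> ~ I x.
have [|P [[hP PU] maxP]] := @Zorn_bigcup R F.
  move=> C CF Ctot; split; last by move=> x Ux [I CI Ix]; apply: (CF I CI).2 Ix.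
  split; [split|].
  - move=> x y [I CI Ix] [J CJ Jy].
    have [IJ|JI] := Ctot I J CI CJ.
      by exists J => //; apply: (CF J CJ).1.1.1 => //; apply: IJ.
    by exists I => //; apply: (CF I CI).1.1.1 => //; apply: JI.
  - by move=> r x [I CI Ix]; exists I => //; apply: (CF I CI).1.1.2.
  - by move=> x r [I CI Ix]; exists I => //; apply: (CF I CI).1.2.
have larger I : ideal I -> (P `<=` I)%classic -> ~ (I `<=` P)%classic ->
    exists2 x, U x & I x.
  move=> hI PI IP; apply: contrapT => nU.
  by apply: (maxP I) => //; split=> // x Ux Ix; apply: nU; exists x.
(* Without [0], [P] is empty; then [[set 0]] is strictly larger and has to meet [U]. *)
exists P; split=> //; apply: contrapT => nP0.
have [|x Px|sub0|x Ux x0] := larger [set 0]%classic.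
- by split; [split|] => [x y -> ->|r x ->|x r ->] /=; rewrite ?addr0 ?mulr0 ?mul0r.
- by case: nP0; rewrite -(mul0r x); apply: hP.1.2.
- by apply: nP0; apply: sub0.
- by apply: U0; have <- : x = 0 by [].
Qed.

Lemma avoiding_ideal_prime (R : pzRingType) (U P : set R) (P0 : P 0)
    (hP : ideal P) (PU : forall x, U x -> ~ P x)
    (maxP : forall I, ideal I -> (P `<=` I)%classic -> ~ (I `<=` P)%classic ->
      exists2 x, U x & I x)
    (prodU : forall A B : set R, ideal A -> ideal B ->
      (exists2 x, U x & A x) -> (exists2 x, U x & B x) ->
      (forall x y, A x -> B y -> P (x * y)) -> exists2 x, U x & P x) :
  prime_ideal P.
Proof.
have [[PD PM] PMr] := hP; split=> // x y xRy.
apply: contrapT => /not_orP[nPx nPy].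
(* Modulo [P], [A] is the left annihilator of [R y] and [B] the right annihilator of [A]. They
   contain [x] and [y] respectively, so by maximality both meet [U]. *)
pose A : set R := fun s => forall r, P (s * r * y).
pose B : set R := fun t => forall s, A s -> P (s * t).
have hA : ideal A.
  split; [split|] => [s t As At r|r s As t|s r As t].
  - by rewrite !mulrDl; apply: PD.
  - by rewrite -!mulrA; apply: PM; rewrite mulrA.
  - by rewrite -(mulrA s).
have hB : ideal B.
  split; [split|] => [s t Bs Bt u Au|r s Bs u Au|s r Bs u Au].
  - by rewrite mulrDr; apply: PD; [apply: Bs | apply: Bt].
  - by rewrite mulrA; apply: Bs; apply: hA.2.
  - by rewrite mulrA; apply: PMr; apply: Bs.
have [||s Us Ps] := prodU A B hA hB _ _ (fun s t As Bt => Bt s As).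
- apply: maxP => // [s Ps r|AP]; first by do 2 apply: (PMr).
  by apply: nPx; apply: AP.
- apply: maxP => // [s Ps t At|BP]; first by apply: PM.
  by apply: nPy; apply: BP => s As; rewrite -[s]mulr1; apply: As.
- exact: PU Ps.
Qed.

(** * Defects of strong pi-regularity *)

(* Raising the exponent of the multiple of [a] is what makes the product of two
   defects a defect, although [r] need not commute with [a]. *)
Lemma ideal_pow_telescope (R : pzRingType) (I : set R) (hI : ideal I) (I0 : I 0)
    (a r : R) (m j : nat) :
  I (a ^+ m - a ^+ m.+1 * r) -> I (a ^+ m - a ^+ (m + j) * r ^+ j).
Proof.
move: hI => [[ID IM] IMr] h; elim: j => [|j IHj].
  by rewrite addn0 expr0 mulr1 subrr.
rewrite -(subrK (a ^+ (m + j) * r ^+ j) (a ^+ m)) -addrA; apply: ID => //.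
have -> : a ^+ (m + j) * r ^+ j - a ^+ (m + j.+1) * r ^+ j.+1
    = a ^+ j * (a ^+ m - a ^+ m.+1 * r) * r ^+ j.
  by rewrite mulrBr mulrA -!exprD mulrBl addnS addnC (addnS j) exprS -!mulrA exprS.
by apply: IMr; apply: IM.
Qed.

Definition pi_defect (R : pzRingType) (a : R) : set R :=
  fun x => exists m r, x = a ^+ m - a ^+ m.+1 * r.

Lemma pi_defect_prod (R : pzRingType) (a : R) (P A B : set R) (A0 : A 0)
    (hA : ideal A) :
  (exists2 x, pi_defect a x & A x) -> (exists2 x, pi_defect a x & B x) ->
  (forall x y, A x -> B y -> P (x * y)) -> exists2 x, pi_defect a x & P x.
Proof.
move=> [_ [m [r ->]] Ax] [_ [k [s ->]] By] AB.
(* With [k.+1] extra factors, the cross term is already a right multiple of [a ^+ (m + k).+1]. *)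
have := AB _ _ (ideal_pow_telescope hA A0 k.+1 Ax) By.
set t := r ^+ k.+1; set y := a ^+ k - a ^+ k.+1 * s => Pxy.
exists (a ^+ (m + k) - a ^+ (m + k).+1 * (s + t * y)); first by exists (m + k)%N, (s + t * y).
suff <- : (a ^+ m - a ^+ (m + k.+1) * t) * y = a ^+ (m + k) - a ^+ (m + k).+1 * (s + t * y) by [].
rewrite mulrBl {1}/y mulrBr; move: y {Pxy} => y.
by rewrite mulrA -!exprD !addnS mulrDr opprD addrA !mulrA.
Qed.

Lemma prime_ideal_avoiding_pi_defect (R : pzRingType) (a : R) :
  ~ pi_defect a 0 ->
  exists2 P : set R, prime_ideal P & forall x, pi_defect a x -> ~ P x.
Proof.
move=> /maximal_avoiding_ideal[P [P0 hP PU maxP]]; exists P => //.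
apply: (avoiding_ideal_prime P0 hP PU maxP) => A B hA hB aA.
apply: pi_defect_prod => //.
by have [x _ Ax] := aA; rewrite -(mul0r x); apply: hA.1.2.
Qed.

(** * Levitzki's theorem modulo a prime ideal *)

(* Levitzki's argument: putting [u' := u (s u)^k] for [u], the identity for
   [s u + r u'] loses all but one term and yields the identity of lower degree
   for [u']. *)
Lemma prime_ideal_pow_identity (R : pzRingType) (P : set R) (hP : prime_ideal P)
    (k : nat) (u : R) :
  (forall r, P (u * (r * u) ^+ k)) -> P u.
Proof.
have [P0 [[PD PM] PMr] Pprime] := hP.
have PB := left_idealB (conj PD PM).
elim: k u => [|[|k] IHk] u hu; first by have := hu 0; rewrite expr0 mulr1.
  by case: (Pprime u u) => // r; rewrite -mulrA -[r * u]expr1.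
apply: (IHk) => s; apply: (IHk) => r.
set x := s * u; set u' := u * x ^+ k.+1; set w := r * u'.
set c := u * x ^+ k.
have cx : c * x = u' by rewrite -mulrA -exprSr.
have Pu'x : P (u' * x) by rewrite -mulrA -exprSr; apply: hu.
have Pwx : P (w * x) by rewrite -mulrA; apply: PM.
have Pu'wx j : P (u' * w ^+ j * x).
  case: j => [|j]; first by rewrite expr0 mulr1.
  by rewrite exprSr mulrA -(mulrA _ w); apply: PM.
have uxE j : exists d, u * x ^+ j = d * u.
  elim: j => [|j [d hd]]; first by exists 1; rewrite expr0 mulr1 mul1r.
  by exists (d * u * s); rewrite exprSr mulrA hd -!mulrA.
have [d cd] := uxE k; have [d' u'd] := uxE k.+1.
(* Modulo [P], [w * x] and [c * x * x = u' * x] vanish, so in the expansion [x] survives only once,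
   right after [c], where [c * x = u']. *)
have step j : P (c * (x + w) ^+ j.+1 - (u' * w ^+ j + c * w ^+ j.+1)).
  elim: j => [|j IHj]; first by rewrite expr0 !expr1 mulr1 mulrDr cx subrr.
  rewrite exprSr mulrA; set z := c * _; set y := u' * w ^+ j + c * w ^+ j.+1 in IHj *.
  have <- : y * w = u' * w ^+ j.+1 + c * w ^+ j.+2.
    by rewrite /y mulrDl -!mulrA -!exprSr.
  have -> : z * (x + w) - y * w = (z - y) * (x + w) + y * x.
    by rewrite mulrBl (mulrDr y) [y * x + _]addrC opprD addrA subrK.
  apply: (PD); first by apply: PMr.
  rewrite /y mulrDl; apply: (PD); first exact: Pu'wx.
  by rewrite exprSr mulrA -(mulrA _ w); apply: PM.
(* Both [w] and [x + w] are left multiples of [u], so [hu] applies to each. *)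
have wE : w = r * d' * u by rewrite -mulrA -u'd.
have Pcw : P (c * w ^+ k.+2).
  by rewrite /c cd -mulrA wE; apply: PM; apply: hu.
have Pcxw : P (c * (x + w) ^+ k.+2).
  by rewrite /c cd -mulrA wE -mulrDl; apply: PM; apply: hu.
have := left_idealB (conj PD PM) Pcxw (step k.+1).
rewrite opprB addrC subrK => h.
by rewrite -(addrK (c * w ^+ k.+2) (u' * _)); apply: PB.
Qed.

(** * Idempotents from weak nil cleanness *)

Lemma unipotent_unit (R : pzRingType) (q : R) :
  is_nilpotent q -> exists2 v, (1 + q) * v = 1 & v * (1 + q) = 1.
Proof.
move=> [n [_ qn]]; pose v := \sum_(i < n) (- q) ^+ i.
have cqv : GRing.comm (1 + q) v.
  apply: commr_sum => i _; apply: commrX; apply: commrN.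
  by apply: commr_sym; apply: commrD; [apply: commr1 | apply: commr_refl].
have uv : (1 + q) * v = 1.
  apply: oppr_inj; rewrite -mulNr opprD addrC -subrX1.
  by rewrite exprNn qn mulr0 sub0r.
by exists v => //; rewrite -cqv.
Qed.

(** Multiplying [x = e + q + e r x] by [e] gives [e (1 + q) = e (1 - r) x]. So the conjugate of [e]
    by the unit [1 + q] lies in [R x]; it generates the same ideal as [e], and that ideal contains
    [x - q]. *)
Lemma weakly_nil_clean_idempotent (R : pzRingType) (x : R) :
  weakly_nil_clean R ->
  exists g q y s t, [/\ g * g = g, g = y * x, is_nilpotent q & x - q = s * g * t].
Proof.
move=> /(_ x)[e [q [ee qnil [r hr]]]]; have [v uv vu] := unipotent_unit qnil.
set u := 1 + q in uv vu.
have xE : x = e + q + e * r * x by rewrite -hr -[x - e - q]addrA -opprD [RHS]addrC subrK.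
have eu : e * u = e * (1 - r) * x.
  rewrite mulrBr mulr1 mulrBl {1}xE !mulrDr !mulrA ee addrK.
  by rewrite mulr1.
exists (v * e * u), q, (v * e * (1 - r)), u, (v * (1 + r * x)).
split=> //.
- by rewrite -!mulrA (mulrA u) uv mul1r (mulrA e) ee.
- by rewrite -!mulrA (mulrA e) -eu.
- rewrite !mulrA uv mul1r -(mulrA e u) uv mulr1 mulrDr mulr1 mulrA.
  by rewrite {1}xE addrAC addrK.
Qed.

Lemma idempotent_outside_prime (R : pzRingType) (hwnc : weakly_nil_clean R)
    (hbi : bounded_index R) (P : set R) (hP : prime_ideal P) (M : set R)
    (hM : forall r x, M x -> M (r * x)) :
  ~ (M `<=` P)%classic -> exists h, [/\ h * h = h, M h & ~ P h].
Proof.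
have [P0 hI _] := hP; have [[PD PM] PMr] := hI; have [n [n0 nilX]] := hbi.
move=> MP; apply: contrapT => noidem; apply: MP => x Mx.
(* If all idempotents of [M] are in [P], then [r * x] is congruent to a nilpotent, so its [n]-th
   power is in [P]. *)
apply: (prime_ideal_pow_identity hP (k := n)) => r; apply: (PM).
have Mrx : M (r * x) by apply: hM.
have [g [q [y [s [t [gg gE qnil zE]]]]]] := weakly_nil_clean_idempotent (r * x) hwnc.
have Pg : P g.
  apply: contrapT => nPg; apply: noidem; exists g; split=> //.
  by rewrite gE; apply: hM.
rewrite -[_ ^+ n]subr0 -(nilX q qnil).
apply: ideal_subX => //.
by rewrite zE; apply: PMr; apply: PM.
Qed.

(** * Orthogonal idempotents and left ideals modulo a prime *)

(* A nilpotent witness for [k + 1] orthogonal idempotents outside [P], with sum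
   [g] and first member [h]: the element [x] plays the role of a superdiagonal
   matrix relative to them. *)
Definition nilpotent_chain (R : pzRingType) (P : set R) (k : nat) (g : R) : Prop :=
  exists h x, [/\ g * h = h, h * g = h, g * x = x, x * g = x &
                  x ^+ k.+1 = 0 /\ ~ P (h * x ^+ k)].

Lemma nilpotent_chain_extend (R : pzRingType) (P : set R) (hP : prime_ideal P)
    (k : nat) (g h : R) :
  g * g = g -> h * h = h -> g * h = 0 -> h * g = 0 -> ~ P h ->
  nilpotent_chain P k g -> nilpotent_chain P k.+1 (g + h).
Proof.
have [_ _ Pprime] := hP.
move=> gg hh gh hg nPh [h0 [x [gh0 h0g gx xg [xk nPx]]]].
have [r nPr] : exists r, ~ P (h * r * (h0 * x ^+ k)).
  by apply/existsNP => hr; case: (Pprime _ _ hr).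
(* The new superdiagonal entry, linking [h] to the former first idempotent [h0]. *)
pose z := h * r * h0.
have hx : h * x = 0 by rewrite -gx mulrA hg mul0r.
have xh : x * h = 0 by rewrite -xg -mulrA gh mulr0.
have h0h : h0 * h = 0 by rewrite -h0g -mulrA gh mulr0.
have hz : h * z = z by rewrite /z !mulrA hh.
have gz : g * z = 0 by rewrite /z !mulrA gh !mul0r.
have zh : z * h = 0 by rewrite /z -mulrA h0h mulr0.
have zg : z * g = z by rewrite /z -mulrA h0g.
have zz : z * z = 0 by rewrite -{2}hz mulrA zh mul0r.
have xz : x * z = 0 by rewrite -hz mulrA xh mul0r.
have powE j : (z + x) ^+ j.+1 = z * x ^+ j + x ^+ j.+1.
  elim: j => [|j IHj]; first by rewrite expr0 mulr1 !expr1.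
  by rewrite exprS IHj mulrDl !mulrDr (mulrA z z) zz (mulrA x z) xz !mul0r !add0r -exprS.
exists h, (z + x); split.
- by rewrite mulrDl gh hh add0r.
- by rewrite mulrDr hg hh add0r.
- by rewrite mulrDl !mulrDr gz gx hz hx addr0 add0r addrC.
- by rewrite mulrDr !mulrDl zg xg zh xh !addr0.
- split; first by rewrite powE xk exprS xk !mulr0 addr0.
  by rewrite powE xk addr0 mulrA hz /z -mulrA.
Qed.

Lemma left_ideal_idempotent_mod_prime (R : pzRingType)
    (hwnc : weakly_nil_clean R) (hbi : bounded_index R) (P : set R)
    (hP : prime_ideal P) (L : set R) (hL : left_ideal L) (L0 : L 0) :
  exists g, [/\ g * g = g, L g & forall x, L x -> P (x * (1 - g))].
Proof.
have [P0 [[PD PM] PMr] _] := hP; have [LD LM] := hL.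
apply: contrapT => noidem.
have next g : g * g = g -> L g -> exists h,
    [/\ h * h = h, g * h = 0, h * g = 0, L h & ~ P h].
  move=> gg Lg; pose M : set R := fun y => exists2 x, L x & y = x * (1 - g).
  have [|MP|h [hh [x Lx hE] nPh]] := idempotent_outside_prime hwnc hbi hP (M := M).
  - by move=> r _ [x Lx ->]; exists (r * x); [apply: LM | rewrite mulrA].
  - by apply: noidem; exists g; split=> // x Lx; apply: MP; exists x.
  have hg : h * g = 0 by rewrite hE -mulrA mulrBl mul1r gg subrr mulr0.
  have Lh : L h by rewrite hE mulrBr mulr1; apply: left_idealB => //; apply: LM.
  have hh' : h * ((1 - g) * h) = h by rewrite mulrA mulrBr mulr1 hg subr0 hh.
  (* The factor [1 - g] makes [h] orthogonal to [g] on the left too. *)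
  exists ((1 - g) * h); split.
  - by rewrite -mulrA hh'.
  - by rewrite mulrA mulrBr mulr1 gg subrr mul0r.
  - by rewrite -mulrA hg mulr0.
  - exact: LM.
  - by move=> Ph; apply: nPh; rewrite -hh'; apply: PM.
have chain k : exists g, [/\ g * g = g, L g & nilpotent_chain P k g].
  elim: k => [|k [g [gg Lg ch]]].
    have [h [hh _ _ Lh nPh]] := next 0 (mul0r 0) L0.
    exists h; split=> //; exists h, 0.
    by rewrite hh mulr0 mul0r expr1 expr0 mulr1.
  have [h [hh gh hg Lh nPh]] := next g gg Lg.
  exists (g + h); split; last exact: nilpotent_chain_extend.
    by rewrite mulrDl !mulrDr gg gh hg hh addr0 add0r.
  exact: LD.
have [n [n0 nilX]] := hbi.
have [g [_ _ [h [x [_ _ _ _ [xn nPx]]]]]] := chain n.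
by apply: nPx; rewrite nilX ?mulr0 //; exists n.+1.
Qed.

(** * A defect in every prime ideal, and the conclusion *)

Lemma pi_defect_in_prime (R : pzRingType) (hwnc : weakly_nil_clean R)
    (hbi : bounded_index R) (P : set R) (hP : prime_ideal P) (a : R) :
  exists2 x, pi_defect a x & P x.
Proof.
have [P0 [[PD PM] PMr] _] := hP.
pose L : set R := fun x => exists k, P (x * a ^+ k).
have up x k j : P (x * a ^+ k) -> P (x * a ^+ (k + j)).
  by move=> h; rewrite exprD mulrA; apply: PMr.
have hL : left_ideal L.
  split=> [x y [k xk] [l yl]|r x [k xk]]; last first.
    by exists k; rewrite -mulrA; apply: PM.
  exists (k + l)%N; rewrite mulrDl; apply: PD; first exact: up.
  by rewrite addnC; apply: up.
have L0 : L 0 by exists 0%N; rewrite mul0r.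
have [g [gg [k gk] Lg]] := left_ideal_idempotent_mod_prime hwnc hbi hP hL L0.
have stable x : L x -> P (x * a ^+ k).
  move=> Lx; rewrite -[x]mulr1 -(subrK g 1) mulrDr mulrDl.
  by apply: PD; [apply: PMr; apply: Lg | rewrite -mulrA; apply: PM].
pose b := a ^+ k.+1; pose Rb : set R := fun x => exists y, x = y * b.
have [||e [_ [y eE] be]] := left_ideal_idempotent_mod_prime hwnc hbi hP (L := Rb).
- split=> [_ _ [x ->] [y ->]|r _ [x ->]]; first by exists (x + y); rewrite mulrDl.
  by exists (r * x); rewrite mulrA.
- by exists 0; rewrite mul0r.
exists (a ^+ k - a ^+ k.+1 * (y * a ^+ k)); first by exists k, (y * a ^+ k).
(* With [e = y * b], [(1 - b * y) * b = b * (1 - e)] is in [P]; [stable] then lowers the exponent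
   from [k.+1] to [k]. *)
rewrite mulrA -[X in X - _]mul1r -mulrBl; apply: stable; exists k.+1.
rewrite mulrBl mul1r -/b -mulrA -eE -[X in X - _]mulr1 -mulrBr; apply: be.
by exists 1; rewrite mul1r.
Qed.

Theorem proposition3p10 (R : pzRingType) (hwnc : weakly_nil_clean R)
  (hbi : bounded_index R) : strongly_pi_regular R.
Proof.
move=> a; have [m [r /esym/eqP]] : pi_defect a 0.
  apply: contrapT => /prime_ideal_avoiding_pi_defect[P hP aP].
  by have [x ax Px] := pi_defect_in_prime hwnc hbi hP a; apply: aP Px.
(* Since [m] may be 0, the identity is multiplied by [a] on the left. *)
rewrite subr_eq0 => /eqP amE; exists m.+1; split=> //; exists r.
by rewrite exprS {1}amE mulrA -exprS.
Qed.
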